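(* For (smooth solutions of) the regularized quasi-hydrodynamic (QHD) system of PDEs given in the context, the following balance PDE for the mixture entropy with non-negative entropy production is valid: $$\partial_t(\rho s)+\mathrm{div}\Big(\rho s(\mathbf{u}-\widehat{\mathbf{w}})+\frac{1}{\theta}\mathbf{q}^F\Big) =\frac{1}{\theta}\Big\{\frac{\mu}{2}\big|\nabla\mathbf{u}+(\nabla\mathbf{u})^T\big|_F^2+\Big(\lambda-\frac23\mu\Big)(\mathrm{div}\,\mathbf{u})^2+\frac{\varkappa}{\theta}|\nabla\theta|^2+\frac{\rho}{\tau}|\widehat{\mathbf{w}}|^2+Q\Big\}\geq 0,$$ where $|\cdot|_F$ is the Frobenius norm and $s$ is the mixture specific entropy.
   Context: $\langle\cdot\rangle$ denotes summation over $k=1,2$. Physical constants for $k=1,2$: $c_{Vk}>0$, $\gamma_k>1$, $R_k=(\gamma_k-1)c_{Vk}>0$, $p_{*k}\geq 0$, $\varepsilon_{0k}\in\mathbb{R}$. The mixture is described at each $(x,t)$, $x\in\Omega\subset\mathbb{R}^n$ ($n=1,2,3$), $t\ge0$, by component densities $r_k>0$, volume fractions $0<\alpha_k<1$, temperature $\theta>0$ and velocity $\mathbf{u}$, with $\alpha_1+\alpha_2=1$ and equal component pressures $p=p_1=p_2>0$, $p_k=R_kr_k\theta-p_{*k}$; the component specific internal energies are $\varepsilon_k=c_{Vk}\theta+p_{*k}/r_k+\varepsilon_{0k}$. Put $\rho_k=\alpha_kr_k$, $\rho=\langle\rho_k\rangle$, $\rho\varepsilon=\langle\rho_k\varepsilon_k\rangle$,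 $E=\tfrac12\rho|\mathbf{u}|^2+\rho\varepsilon$. (The state is equivalently determined by $\rho_1,\rho_2,\varepsilon$: $p$ is the larger root of $p^2-bp-c=0$ with $b=\langle\sigma^{(k)}(\rho(\varepsilon-\varepsilon_0)-p_{*k})-p_{*k}\rangle$, $c=(\sigma^{(1)}p_{*2}+\sigma^{(2)}p_{*1})\rho(\varepsilon-\varepsilon_0)-\gamma p_{*1}p_{*2}$, where $\rho\varepsilon_0=\langle\rho_k\varepsilon_{0k}\rangle$, $\sigma^{(k)}=R_k\rho_k/\langle c_{Vl}\rho_l\rangle$, $\gamma=1+\langle\sigma^{(k)}\rangle$; then $\theta=\langle R_k\rho_k/(p+p_{*k})\rangle^{-1}$ and $\alpha_k=R_k\rho_k\theta/(p+p_{*k})$, $r_k=\rho_k/\alpha_k$.) The QHD system is $$\partial_t\rho_k+\mathrm{div}\big(\rho_k(\mathbf{u}-\widehat{\mathbf{w}})\big)=0,\ k=1,2,$$ $$\partial_t(\rho\mathbf{u})+\mathrm{div}\big(\rho(\mathbf{u}-\widehat{\mathbf{w}})\otimes\mathbf{u}\big)+\nabla p=\mathrm{div}(\Pi^{NS}+\widehat{\Pi}^\tau)+\rho\mathbf{f},$$ $$\partial_tE+\mathrm{div}\big((E+p)(\mathbf{u}-\widehat{\mathbf{w}})\big)=\mathrm{div}\big(-\mathbf{q}^F+(\Pi^{NS}+\widehat{\Pi}^\tau)\mathbf{u}\big)+\rho(\mathbf{u}-\widehat{\mathbf{w}})\cdot\mathbf{f}+Q,$$ where $$\widehat{\mathbf{w}}=\tau\Big((\mathbf{u}\cdot\nabla)\mathbf{u}+\frac1\rho\nabla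 p-\mathbf{f}\Big),\quad \widehat{\Pi}^\tau=\rho\mathbf{u}\otimes\widehat{\mathbf{w}},\quad \Pi^{NS}=\mu(\nabla\mathbf{u}+(\nabla\mathbf{u})^T)+(\lambda-\tfrac23\mu)(\mathrm{div}\,\mathbf{u})\mathbb{I},\quad -\mathbf{q}^F=\varkappa\nabla\theta.$$ Here $\tau>0$ is a regularization parameter (possibly depending on the unknown functions), $\mu,\lambda,\varkappa\geq0$ may depend on the unknown functions, $\mathbf{f}$ is a given body force density, $Q\geq0$ a given heat source intensity, $\nabla\mathbf{u}=\{\partial_iu_j\}_{i,j=1}^n$, $\mathbb{I}$ is the unit tensor, and the divergence of a tensor is taken with respect to its first index. The $k$th component specific entropy $s_k(r_k,\varepsilon_k)$ is defined by the thermodynamic equations $\partial_{r_k}s_k=-\dfrac{p_k}{r_k^2\theta}$, $\partial_{\varepsilon_k}s_k=\dfrac1\theta$, $k=1,2$ (with $p_k,\theta$ expressed through $(r_k,\varepsilon_k)$ by the equations of state), and the mixture specific entropy $s$ is given by $\rho s=\langle\rho_ks_k\rangle$. *)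

(* Defs.v *)
From HB Require Import structures.
From mathcomp Require Import all_boot all_order all_algebra.
From mathcomp Require Import all_classical all_reals all_analysis.
Set Implicit Arguments.
Unset Strict Implicit.
Unset Printing Implicit Defensive.
Import Order.TTheory GRing.Theory Num.Theory.
Import numFieldNormedType.Exports.
Local Open Scope classical_set_scope.
Local Open Scope ring_scope.

(* Fields are total functions of position and time. Vectors are rows; a tensor
   T has entry T i j in row i and column j. Everything below is only ever
   required for x in an open set Omega and for t >= 0. The derivatives are the
   two-sided ones of the library, so at t = 0 a field is implicitly continued
   to t < 0; a two-sided derivative equals the one-sided one, and a field with
   a one-sided time derivative at t = 0 always has such a continuation. *)
Definition sfield (R : realType) (n : nat) := 'rV[R]_n -> R -> R.
Definition vfield (R : realType) (n : nat) := 'rV[R]_n -> R -> 'rV[R]_n.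
Definition tfield (R : realType) (n : nat) := 'rV[R]_n -> R -> 'M[R]_n.

Section Calculus.
Context {R : realType} {n : nat}.

Definition dotv (a b : 'rV[R]_n) : R := \sum_i a 0 i * b 0 i.

(* The library norm on matrices is the maximum norm, so the squared Euclidean
   and Frobenius norms are written out. *)
Definition norm2sq (a : 'rV[R]_n) : R := dotv a a.
Definition frobsq (A : 'M[R]_n) : R := \sum_i \sum_j A i j ^+ 2.

Definition tensor (a b : 'rV[R]_n) : 'M[R]_n := \matrix_(i, j) (a 0 i * b 0 j).

Definition dt {W : normedModType R} (g : 'rV[R]_n -> R -> W)
    (x : 'rV[R]_n) (t : R) : W := derive1 (g x) t.

Definition dx (i : 'I_n) (g : sfield R n) : sfield R n :=
  fun x t => 'D_(delta_mx 0 i) (fun y => g y t) x.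

Definition grad (g : sfield R n) : vfield R n :=
  fun x t => \row_i dx i g x t.

(* (grad v)_(i, j) is the derivative of v_j in direction i. *)
Definition gradv (v : vfield R n) : tfield R n :=
  fun x t => \matrix_(i, j) dx i (fun y t' => v y t' 0 j) x t.

Definition div (v : vfield R n) : sfield R n :=
  fun x t => \sum_i dx i (fun y t' => v y t' 0 i) x t.

(* The divergence acts on the first index of the tensor. *)
Definition divt (T : tfield R n) : vfield R n :=
  fun x t => \row_j \sum_i dx i (fun y t' => T y t' i j) x t.

Definition dt_exists (Omega : set 'rV[R]_n) (g : sfield R n) : Prop :=
  forall x t, Omega x -> 0 <= t -> derivable (g x) t 1.

Definition dx_exists (Omega : set 'rV[R]_n) (g : sfield R n) : Prop :=
  forall i x t, Omega x -> 0 <= t ->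
    derivable (fun y => g y t) x (delta_mx 0 i).

Definition dxx_exists (Omega : set 'rV[R]_n) (g : sfield R n) : Prop :=
  dx_exists Omega g /\ forall i, dx_exists Omega (dx i g).

End Calculus.

Record constants (R : realType) := Constants {
  cV : 'I_2 -> R;
  gma : 'I_2 -> R;
  pst : 'I_2 -> R;
  ep0 : 'I_2 -> R;
  cV_gt0 : forall k, 0 < cV k;
  gma_gt1 : forall k, 1 < gma k;
  pst_ge0 : forall k, 0 <= pst k }.

Definition Rg (R : realType) (c : constants R) (k : 'I_2) : R :=
  (gma c k - 1) * cV c k.

Record mixture (R : realType) (n : nat) := Mixture {
  mr : 'I_2 -> sfield R n;
  malpha : 'I_2 -> sfield R n;
  mtheta : sfield R n;
  mp : sfield R n;
  mvel : vfield R n }.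

(* The coefficients tau, mu, lambda and kappa may depend on the unknown
   functions: these fields are their values along the solution. *)
Record qhd_data (R : realType) (n : nat) := QHDData {
  dtau : sfield R n;
  dmu : sfield R n;
  dlambda : sfield R n;
  dkappa : sfield R n;
  df : vfield R n;
  dQ : sfield R n }.

Section Thermodynamics.
Context {R : realType} (c : constants R).

Definition press (k : 'I_2) (r theta : R) : R := Rg c k * r * theta - pst c k.
Definition energy (k : 'I_2) (r theta : R) : R :=
  cV c k * theta + pst c k / r + ep0 c k.

(* Temperature and pressure through (r, e), by solving energy k r theta = e. *)
Definition theta_re (k : 'I_2) (r e : R) : R :=
  (e - ep0 c k - pst c k / r) / cV c k.
Definition press_re (k : 'I_2) (r e : R) : R := press k r (theta_re k r e).

Definition component_entropy (s : 'I_2 -> R -> R -> R) : Prop :=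
  forall k r e, 0 < r -> 0 < theta_re k r e -> 0 < press_re k r e ->
    is_derive r (1 : R) (fun r' => s k r' e)
      (- (press_re k r e / (r ^+ 2 * theta_re k r e))) /\
    is_derive e (1 : R) (fun e' => s k r e') (theta_re k r e)^-1.

End Thermodynamics.

Section System.
Context {R : realType} {n : nat} (c : constants R).
Context (m : mixture R n) (d : qhd_data R n).

Definition rhok (k : 'I_2) : sfield R n :=
  fun x t => malpha m k x t * mr m k x t.
Definition rho : sfield R n := fun x t => \sum_k rhok k x t.
Definition epsk (k : 'I_2) : sfield R n :=
  fun x t => energy c k (mr m k x t) (mtheta m x t).
Definition rhoeps : sfield R n := fun x t => \sum_k rhok k x t * epsk k x t.
Definition toten : sfield R n :=
  fun x t => 2^-1 * rho x t * norm2sq (mvel m x t) + rhoeps x t.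

(* s, defined by rho s = rho_1 s_1 + rho_2 s_2. *)
Definition mix_entropy (s : 'I_2 -> R -> R -> R) : sfield R n :=
  fun x t =>
    (\sum_k rhok k x t * s k (mr m k x t) (epsk k x t)) / rho x t.

Definition what : vfield R n := fun x t =>
  dtau d x t *: (mvel m x t *m gradv (mvel m) x t
                 + (rho x t)^-1 *: grad (mp m) x t - df d x t).

Definition regvel : vfield R n := fun x t => mvel m x t - what x t.

Definition PiTau : tfield R n :=
  fun x t => rho x t *: tensor (mvel m x t) (what x t).

Definition PiNS : tfield R n := fun x t =>
  dmu d x t *: (gradv (mvel m) x t + (gradv (mvel m) x t)^T)
  + ((dlambda d x t - 2 / 3 * dmu d x t) * div (mvel m) x t)%:M.

Definition PiTot : tfield R n := fun x t => PiNS x t + PiTau x t.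

Definition qF : vfield R n :=
  fun x t => - (dkappa d x t *: grad (mtheta m) x t).

(* v *m T^T is the row vector of the product T v. *)
Record qhd_at (x : 'rV[R]_n) (t : R) : Prop := QHDAt {
  qhd_mass : forall k,
    dt (rhok k) x t + div (fun y t' => rhok k y t' *: regvel y t') x t = 0;
  qhd_momentum :
    dt (fun y t' => rho y t' *: mvel m y t') x t
    + divt (fun y t' => rho y t' *: tensor (regvel y t') (mvel m y t')) x t
    + grad (mp m) x t
    = divt PiTot x t + rho x t *: df d x t;
  qhd_energy :
    dt toten x t
    + div (fun y t' => (toten y t' + mp m y t') *: regvel y t') x t
    = div (fun y t' => - qF y t' + mvel m y t' *m (PiTot y t')^T) x t
      + rho x t * dotv (regvel x t) (df d x t) + dQ d x t }.

Record admissible_at (x : 'rV[R]_n) (t : R) : Prop := AdmissibleAt {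
  adm_r : forall k, 0 < mr m k x t;
  adm_alpha : forall k, 0 < malpha m k x t < 1;
  adm_theta : 0 < mtheta m x t;
  adm_alpha_sum : \sum_k malpha m k x t = 1;
  adm_p : forall k, mp m x t = press c k (mr m k x t) (mtheta m x t);
  adm_p_gt0 : 0 < mp m x t;
  adm_tau : 0 < dtau d x t;
  adm_mu : 0 <= dmu d x t;
  adm_lambda : 0 <= dlambda d x t;
  adm_kappa : 0 <= dkappa d x t;
  adm_Q : 0 <= dQ d x t }.

(* Classical regularity: enough partial derivatives for every term of the
   system to be meaningful. No continuity of them is required. *)
Record regular (Omega : set 'rV[R]_n) : Prop := Regular {
  reg_r : forall k,
    dt_exists Omega (mr m k) /\ dxx_exists Omega (mr m k);
  reg_alpha : forall k,
    dt_exists Omega (malpha m k) /\ dxx_exists Omega (malpha m k);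
  reg_theta : dt_exists Omega (mtheta m) /\ dxx_exists Omega (mtheta m);
  reg_u : forall j, dt_exists Omega (fun x t => mvel m x t 0 j) /\
                    dxx_exists Omega (fun x t => mvel m x t 0 j);
  reg_tau : dx_exists Omega (dtau d);
  reg_mu : dx_exists Omega (dmu d);
  reg_lambda : dx_exists Omega (dlambda d);
  reg_kappa : dx_exists Omega (dkappa d);
  reg_f : forall j, dx_exists Omega (fun x t => df d x t 0 j) }.

Definition qhd_smooth_solution (Omega : set 'rV[R]_n) : Prop :=
  regular Omega /\
  forall x t, Omega x -> 0 <= t -> admissible_at x t /\ qhd_at x t.

End System.

(* Main.v *)
Require Import Defs.
From HB Require Import structures.
From mathcomp Require Import all_boot all_order all_algebra.
From mathcomp Require Import all_classical all_reals all_analysis.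
From mathcomp Require Import ring lra.
Set Implicit Arguments.
Unset Strict Implicit.
Unset Printing Implicit Defensive.
Import Order.TTheory GRing.Theory Num.Theory.
Import numFieldNormedType.Exports.
Local Open Scope classical_set_scope.
Local Open Scope ring_scope.

(** The entropy balance is the internal energy balance divided by the
    temperature.

    Internal energy. Write [v = u - w] for the regularized velocity, with
    [w = what]. All densities are transported by [v], so by mass conservation
    the transport of [rho g] is [rho] times the derivative of [g] along [v].
    Removing [u . (momentum balance)] from the total energy balance therefore
    leaves a balance for [rho eps] ([internal_energy_balance]) with right-hand
    side
      [- p div v + div (kappa grad theta) + PiNS : grad u + Q
       + rho w . ((u . grad) u + grad p / rho - f)].
    The last term gathers the work of the regularizing stress and the
    corrections of the pressure and force works along [w]; by definition of [w]
    it is [rho |w|^2 / tau].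

    Gibbs relation. Each component satisfies
    [theta d s_k = d eps_k - p / r_k^2 d r_k]. Weighting by [rho_k] and summing,
    and using the common pressure and [alpha_1 + alpha_2 = 1], one gets
      [theta d (rho s) = d (rho eps)
                         - sum_k (eps_k + p / r_k - theta s_k) d rho_k]
    for every partial derivative [d] ([gibbs]). Along [v] the densities obey
    [d rho_k = - rho_k div v], which turns the relation into
      [theta (transport of rho s) = (transport of rho eps) + p div v]
    ([entropy_transport]), so the pressure work cancels. Dividing by [theta] and
    writing [div (kappa grad theta) / theta] as a divergence plus
    [kappa |grad theta|^2 / theta^2] gives the stated identity.

    Sign. Only the viscous term needs an argument: the squared trace of a
    matrix is at most [n <= 3] times the sum of its squared diagonal entries,
    and the diagonal of [grad u + (grad u)^T] carries four times that sum
    ([viscous_dissipation_ge0]).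

    Regularity. Fields have partial derivatives only, and [s_k] is given by its
    partial derivatives in [(r, eps)]. Chain rules through [s_k] are
    justified by integrating its equations:
    [s_k = c_V ln theta - R ln r + constant] ([component_entropyE]). *)

(** * Directional derivatives *)

Section DirectionalCalculus.
Context {R : realType} {V : normedModType R}.
Implicit Types (f g : V -> R) (a v : V) (df dg : R).

Lemma der_cst (b : R) a v : is_derive a v (fun=> b) 0.
Proof. exact: is_derive_cst. Qed.

Lemma derD f g a v df dg : is_derive a v f df -> is_derive a v g dg ->
  is_derive a v (fun y => f y + g y) (df + dg).
Proof. exact: is_deriveD. Qed.

Lemma derN f a v df : is_derive a v f df ->
  is_derive a v (fun y => - f y) (- df).
Proof. exact: is_deriveN. Qed.

Lemma derM f g a v df dg : is_derive a v f df -> is_derive a v g dg ->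
  is_derive a v (fun y => f y * g y) (df * g a + f a * dg).
Proof.
move=> fa ga; apply: (is_derive_eq (is_deriveM fa ga)).
by rewrite addrC [df * _]mulrC.
Qed.

Lemma derV f a v df : f a != 0 -> is_derive a v f df ->
  is_derive a v (fun y => (f y)^-1) (- (df / f a ^+ 2)).
Proof.
move=> fa0 [fa <-]; have fV := derivableV fa0 fa.
by split=> //; rewrite deriveV// -[_ *: _]/(_ * _) mulNr mulrC.
Qed.

Lemma der_sum n (f : 'I_n -> V -> R) a v (df : 'I_n -> R) :
  (forall k, is_derive a v (f k) (df k)) ->
  is_derive a v (fun y => \sum_k f k y) (\sum_k df k).
Proof.
move=> fa; rewrite (_ : (fun y => _) = \sum_k f k); first exact: is_derive_sum.
by apply/funext => y; rewrite fct_sumE.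
Qed.

(** Only one-dimensional differentiability of the inner function along [v] is
    available, so the chain rule is that of the restriction to a line. *)
Lemma der_comp (g : R -> R) f a v (dg df : R) :
  is_derive (f a) (1 : R) g dg -> is_derive a v f df ->
  is_derive a v (fun y => g (f y)) (dg * df).
Proof.
move=> gf [fa <-].
set l := fun h : R => f (h *: v + a).
have lE : l 0 = f a by rewrite /l scale0r add0r.
have dl : is_derive (0 : R) (1 : R) l ('D_v f a).
  split; first by move/derivable1P: fa.
  rewrite /derive /l; apply: (congr1 (fun F : R -> R => lim (F @ 0^'))).
  apply/funext => h /=.
  by rewrite -[h *: 1]/(h * 1) mulr1 addr0 scale0r add0r.
have := @is_derive1_comp _ g l 0 dg ('D_v f a).
rewrite lE => /(_ gf dl) [dgl egl].
split; first by apply/derivable1P.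
rewrite -egl /derive /l; apply: (congr1 (fun F : R -> R => lim (F @ 0^'))).
apply/funext => h /=.
by rewrite -[h *: 1]/(h * 1) mulr1 addr0 scale0r add0r.
Qed.

Lemma der_ln f a v df : 0 < f a -> is_derive a v f df ->
  is_derive a v (fun y => ln (f y)) (df / f a).
Proof.
move=> fa0 fa; apply: is_derive_eq (der_comp (is_derive1_ln fa0) fa) _.
by rewrite mulrC.
Qed.

End DirectionalCalculus.

(* [notypeclasses refine] keeps instance resolution away from the premises; it
   would settle the derivative, an existential variable, in another form. *)
Ltac der := repeat first
  [ eassumption | exact: is_derive_id | exact: der_cst
  | notypeclasses refine (derD _ _) | notypeclasses refine (derN _)
  | notypeclasses refine (derM _ _)
  | notypeclasses refine (derV _ _); [by []|]
  | notypeclasses refine (der_ln _ _); [by []|] ].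

Ltac der_eq := notypeclasses refine (is_derive_eq _ _); [by der|].

(** * Component entropies *)

(** A zero derivative on a half-line forces constancy: precomposing with
    [z |-> b + exp z], a bijection from the whole line, reduces this to
    functions differentiable everywhere. *)
Lemma ray_constant (R : realType) (f : R -> R) (b : R) :
  (forall y, b < y -> is_derive y (1 : R) f 0) ->
  forall y z, b < y -> b < z -> f y = f z.
Proof.
move=> f0 y z yb zb.
have := @is_derive_0_is_cst _ (fun h => f (b + expR h))
  (ln (y - b)) (ln (z - b)).
rewrite !lnK ?posrE ?subr_gt0// ![b + _]addrC !subrK; apply => h.
have bh : b < b + expR h by rewrite ltrDl expR_gt0.
have dexp := derD (der_cst b h 1) (is_derive_expR h).
apply: is_derive_eq (der_comp (f := fun h => b + expR h) (f0 _ bh) dexp) _.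
by rewrite mul0r.
Qed.

Section EntropyFormula.
Context {R : realType} (c : constants R).

Lemma Rg_gt0 k : 0 < Rg c k.
Proof. by rewrite mulr_gt0 ?cV_gt0// subr_gt0 gma_gt1. Qed.

Let cV0 k : cV c k != 0.
Proof. by rewrite gt_eqF ?cV_gt0. Qed.

Let Rg0 k : Rg c k != 0.
Proof. by rewrite gt_eqF ?Rg_gt0. Qed.

(** The energy below which the pressure of a component of density [r] stops
    being positive; since [0 <= pst], its temperature is positive above. *)
Definition energy_min k r : R :=
  ep0 c k + pst c k / r + cV c k * pst c k / (Rg c k * r).

Lemma press_re_energy_min k r e : 0 < r ->
  press_re c k r e = Rg c k * r / cV c k * (e - energy_min k r).
Proof.
move=> r0; have rn : r != 0 by rewrite gt_eqF.
rewrite /press_re /press /theta_re /energy_min; field.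
by rewrite rn cV0 Rg0.
Qed.

Lemma press_re_gt0 k r e : 0 < r -> (0 < press_re c k r e) = (energy_min k r < e).
Proof.
move=> r0; rewrite press_re_energy_min// pmulr_rgt0 ?subr_gt0//.
by rewrite divr_gt0 ?cV_gt0// mulr_gt0 ?Rg_gt0.
Qed.

Lemma theta_re_gt0 k r e : 0 < r -> energy_min k r < e -> 0 < theta_re c k r e.
Proof.
move=> r0; rewrite -press_re_gt0// /press_re /press subr_gt0.
move=> /(le_lt_trans (pst_ge0 c k)).
by rewrite pmulr_rgt0// mulr_gt0 ?Rg_gt0.
Qed.

(** A primitive of the thermodynamic equations, as a function of density and
    energy. *)
Definition entropy_fn k r e : R :=
  cV c k * ln (theta_re c k r e) - Rg c k * ln r.

Lemma entropy_fn_e k r e : 0 < theta_re c k r e ->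
  is_derive e (1 : R) (entropy_fn k r) (theta_re c k r e)^-1.
Proof.
move=> th0; rewrite /entropy_fn.
have dth : is_derive e (1 : R) (theta_re c k r) (cV c k)^-1.
  rewrite /theta_re; der_eq.
  by rewrite /= !addr0 mulr0 addr0 mul1r.
der_eq.
by rewrite /= mul0r add0r addr0 mulrA mulfV ?mul1r.
Qed.

Lemma entropy_fn_r k r e : 0 < r -> 0 < theta_re c k r e ->
  is_derive r (1 : R) (entropy_fn k ^~ e)
    (- (press_re c k r e / (r ^+ 2 * theta_re c k r e))).
Proof.
move=> r0 th0; rewrite /entropy_fn; have rn : r != 0 by rewrite gt_eqF.
have dr : is_derive r (1 : R) (@id R) 1 by exact: is_derive_id.
have dth : is_derive r (1 : R) (theta_re c k ^~ e) (pst c k / r ^+ 2 / cV c k).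
  rewrite /theta_re; der_eq.
  by rewrite /=; field; rewrite rn cV0.
der_eq.
rewrite /press_re /press /=; field.
by rewrite rn cV0 gt_eqF.
Qed.

(** The thermodynamic equations only give partial derivatives of [s k].
    Its difference with the explicit primitive is constant on each vertical ray
    of the domain, and these rays overlap for neighbouring densities, so it is
    constant altogether. This gives the chain rule for [s k] without any
    regularity in [(r, e)] jointly. *)
Lemma component_entropyE (s : 'I_2 -> R -> R -> R) : component_entropy c s ->
  exists K : 'I_2 -> R, forall k r e, 0 < r -> energy_min k r < e ->
    s k r e = entropy_fn k r e + K k.
Proof.
move=> hs; pose gap k r e := s k r e + - entropy_fn k r e.
have gap_e k r e : 0 < r -> energy_min k r < e ->
    is_derive e (1 : R) (gap k r) 0.
  move=> r0 re; have th0 := theta_re_gt0 r0 re.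
  have [] := hs k r e r0 th0; first by rewrite press_re_gt0.
  move=> _ de; apply: is_derive_eq (derD de (derN (entropy_fn_e th0))) _.
  by rewrite subrr.
have gap_r k r e : 0 < r -> energy_min k r < e ->
    is_derive r (1 : R) (gap k ^~ e) 0.
  move=> r0 re; have th0 := theta_re_gt0 r0 re.
  have [] := hs k r e r0 th0; first by rewrite press_re_gt0.
  move=> dr _; apply: is_derive_eq (derD dr (derN (entropy_fn_r r0 th0))) _.
  by rewrite subrr.
(* The value on the ray over r, read off at a point one unit above its end. *)
pose g k r := gap k r (energy_min k r + 1).
have gap_ray k r e : 0 < r -> energy_min k r < e -> gap k r e = g k r.
  move=> r0 re; apply: (ray_constant (b := energy_min k r)) => //.
    by move=> y ry; exact: gap_e.
  by rewrite ltrDl.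
exists (fun k => g k 1) => k r e r0 re.
suff <- : g k r = g k 1 by rewrite -(gap_ray k r e)// /gap addrC subrK.
apply: (ray_constant (b := 0)) => // y y0.
have yn : y != 0 by rewrite gt_eqF.
have emin_cont : {for y, continuous (energy_min k)}.
  apply/differentiable_continuous/derivable1_diffP; rewrite /energy_min.
  have dr : is_derive y (1 : R) (@id R) 1 by exact: is_derive_id.
  have yRn : Rg c k * y != 0 by rewrite mulf_neq0.
  by apply: ex_derive; der.
apply: near_eq_is_derive (gap_r k y (energy_min k y + 1) y0 _); last by rewrite ltrDl.
have : \forall z \near y, energy_min k z < energy_min k y + 1.
  by apply: (cvgr_lt (energy_min k y) emin_cont); rewrite ltrDl.
apply: filterS2 (lt_nbhsr y0) => z z0 zy.
by rewrite gap_ray.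
Qed.

End EntropyFormula.

(** * Partial derivatives of fields *)

Section PartialDerivatives.
Context {R : realType} {n : nat}.
Implicit Types (f g : sfield R n) (v : vfield R n) (o : option 'I_n).
Implicit Types (df dg : R).

(** The index [None] stands for time and [Some i] for the [i]th space
    direction, so that one statement covers all the partial derivatives that
    the material derivative combines. *)
Definition has_D (x : 'rV[R]_n) (t : R) o g dg : Prop :=
  if o is Some i then is_derive x (delta_mx 0 i) (fun y => g y t) dg
  else is_derive t (1 : R) (g x) dg.

Definition partial (x : 'rV[R]_n) (t : R) o g : R :=
  if o is Some i then dx i g x t else dt g x t.

Section AtPoint.
Context (x : 'rV[R]_n) (t : R).
Local Notation has_D := (has_D x t).
Local Notation partial := (partial x t).

Lemma has_D_eq o g dg dg' : has_D o g dg -> dg = dg' -> has_D o g dg'.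
Proof. by move=> gD <-. Qed.

Lemma has_D_ext o f g dg : (forall y s, f y s = g y s) ->
  has_D o f dg -> has_D o g dg.
Proof.
by move=> fg; rewrite (_ : f = g)//; apply/funext => y; apply/funext.
Qed.

Lemma has_D_cst o (b : R) : has_D o (fun _ _ => b) 0.
Proof. by case: o => [i|]; exact: der_cst. Qed.

Lemma has_DD o f g df dg : has_D o f df -> has_D o g dg ->
  has_D o (fun y s => f y s + g y s) (df + dg).
Proof. by case: o => [i|]; exact: derD. Qed.

Lemma has_DN o f df : has_D o f df -> has_D o (fun y s => - f y s) (- df).
Proof. by case: o => [i|]; exact: derN. Qed.

Lemma has_DM o f g df dg : has_D o f df -> has_D o g dg ->
  has_D o (fun y s => f y s * g y s) (df * g x t + f x t * dg).
Proof. by case: o => [i|]; exact: derM. Qed.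

Lemma has_DV o f df : f x t != 0 -> has_D o f df ->
  has_D o (fun y s => (f y s)^-1) (- (df / f x t ^+ 2)).
Proof. by case: o => [i|]; exact: derV. Qed.

Lemma has_D_ln o f df : 0 < f x t -> has_D o f df ->
  has_D o (fun y s => ln (f y s)) (df / f x t).
Proof. by case: o => [i|]; exact: der_ln. Qed.

Lemma has_D_sum o p (f : 'I_p -> sfield R n) (df : 'I_p -> R) :
  (forall k, has_D o (f k) (df k)) ->
  has_D o (fun y s => \sum_k f k y s) (\sum_k df k).
Proof.
case: o => [i|] fD.
  exact: (der_sum (f := fun k y => f k y t)).
exact: (der_sum (f := fun k => f k x)).
Qed.

Lemma has_D_partial o g dg : has_D o g dg -> partial o g = dg.
Proof. by case: o => [i|] /= gD; rewrite /dt /dx ?derive1E derive_val. Qed.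

Lemma divE v (dv : 'I_n -> R) :
  (forall i, has_D (Some i) (fun y s => v y s 0 i) (dv i)) ->
  div v x t = \sum_i dv i.
Proof. by move=> vD; apply: eq_bigr => i _; exact: has_D_partial (vD i). Qed.

Lemma dt_row v (dv : 'I_n -> R) (j : 'I_n) :
  (forall j, has_D None (fun y s => v y s 0 j) (dv j)) -> dt v x t 0 j = dv j.
Proof.
move=> vD; rewrite /dt derive1E derive_mx ?mxE; last first.
  by apply/derivable_mxP => i k; rewrite ord1; have [] := vD k.
by have := has_D_partial (vD j); rewrite /= /dt derive1E.
Qed.

(** The derivative along the trajectories of a velocity [v], assembled from
    given partial derivatives. *)
Definition matd (v : 'I_n -> R) (dg : option 'I_n -> R) : R :=
  dg None + \sum_i v i * dg (Some i).

Lemma matdD (v : 'I_n -> R) (dg dh : option 'I_n -> R) :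
  matd v (fun o => dg o + dh o) = matd v dg + matd v dh.
Proof.
rewrite /matd addrACA -big_split /=; congr (_ + _).
by apply: eq_bigr => i _; rewrite mulrDr.
Qed.

Lemma matdZ (v : 'I_n -> R) (a : R) (dg : option 'I_n -> R) :
  matd v (fun o => a * dg o) = a * matd v dg.
Proof.
rewrite /matd mulrDr mulr_sumr; congr (_ + _).
by apply: eq_bigr => i _; rewrite mulrCA.
Qed.

Lemma matd_sum (v : 'I_n -> R) p (dg : 'I_p -> option 'I_n -> R) :
  matd v (fun o => \sum_k dg k o) = \sum_k matd v (dg k).
Proof.
rewrite /matd big_split /= exchange_big /=; congr (_ + _).
by apply: eq_bigr => i _; rewrite mulr_sumr.
Qed.

Lemma eq_matd (v : 'I_n -> R) (dg dh : option 'I_n -> R) :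
  dg =1 dh -> matd v dg = matd v dh.
Proof.
by move=> e; rewrite /matd e; congr (_ + _); apply: eq_bigr => i _; rewrite e.
Qed.

(** Conservative transport of a density is its material derivative plus
    dilatation. *)
Lemma transportE g v (dg : option 'I_n -> R) (dv : 'I_n -> R) :
  (forall o, has_D o g (dg o)) ->
  (forall i, has_D (Some i) (fun y s => v y s 0 i) (dv i)) ->
  dt g x t + div (fun y s => g y s *: v y s) x t
  = matd (fun i => v x t 0 i) dg + g x t * \sum_i dv i.
Proof.
move=> gD vD; rewrite -[dt g x t]/(partial None g) (has_D_partial (gD None)).
rewrite (@divE _ (fun i => dg (Some i) * v x t 0 i + g x t * dv i)); last first.
  move=> i; apply: has_D_ext (has_DM (gD (Some i)) (vD i)) => y s.
  by rewrite mxE.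
rewrite big_split /= -mulr_sumr addrA /matd; congr (_ + _ + _).
by apply: eq_bigr => i _; rewrite mulrC.
Qed.

End AtPoint.

(** At [t = 0] an identity of the model is only known for later times; this
    still determines the two-sided time derivative. *)
Lemma derive_cst_future (f : R -> R) (b t df : R) :
  is_derive t (1 : R) f df -> (forall s, t <= s -> f s = b) -> df = 0.
Proof.
move=> [fD <-] fb; rewrite /derive cvg_at_rightE//.
apply/cvg_lim => //; apply: cvg_near_cst; near=> h.
have h0 : 0 < h by near: h; exact: nbhs_right_gt.
rewrite /= [h *: 1]mulr1 !fb ?subrr ?scaler0//.
by rewrite lerDr ltW.
Unshelve. all: by end_near. Qed.

End PartialDerivatives.

Section DirectionalRegularity.
Context {R : realType} {n : nat} (Omega : set 'rV[R]_n).
Context (Omega_open : open Omega).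
Implicit Types (f g : sfield R n).

Lemma near_field (x : 'rV[R]_n) (t : R) f g : Omega x -> 0 <= t ->
  (forall y s, Omega y -> 0 <= s -> f y s = g y s) ->
  \forall y \near x, f y t = g y t.
Proof.
move=> Ox t0 fg; have : \forall y \near x, Omega y by exact: open_nbhs_nbhs.
by apply: filterS => y Oy; exact: fg.
Qed.

Lemma has_D_local (x : 'rV[R]_n) (t : R) i f g df : Omega x -> 0 <= t ->
  (forall y s, Omega y -> 0 <= s -> f y s = g y s) ->
  has_D x t (Some i) f df -> has_D x t (Some i) g df.
Proof. move=> Ox t0 fg; exact: near_eq_is_derive (near_field Ox t0 fg). Qed.

Lemma dx_exists_local f g : (forall y s, Omega y -> 0 <= s -> f y s = g y s) ->
  dx_exists Omega f -> dx_exists Omega g.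
Proof.
move=> fg fD i x t Ox t0.
exact: near_eq_derivable (near_field Ox t0 fg) (fD i x t Ox t0).
Qed.

Lemma has_D_dx f i x t : dx_exists Omega f -> Omega x -> 0 <= t ->
  has_D x t (Some i) f (dx i f x t).
Proof. by move=> fD Ox t0; apply: derivableP; exact: fD. Qed.

Lemma has_D_dt f x t : dt_exists Omega f -> Omega x -> 0 <= t ->
  has_D x t None f (dt f x t).
Proof.
by move=> fD Ox t0; rewrite /dt derive1E; apply: derivableP; exact: fD.
Qed.

Lemma has_D_dx_exists f (df : 'I_n -> sfield R n) :
  (forall i x t, Omega x -> 0 <= t -> has_D x t (Some i) f (df i x t)) ->
  dx_exists Omega f.
Proof. by move=> fD i x t Ox t0; have [] := fD i x t Ox t0. Qed.

Lemma dx_exists_cst (b : R) : dx_exists Omega (fun _ _ => b).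
Proof. by move=> i x t Ox t0; exact: derivable_cst. Qed.

Lemma dx_existsD f g : dx_exists Omega f -> dx_exists Omega g ->
  dx_exists Omega (fun y s => f y s + g y s).
Proof. by move=> fD gD i x t Ox t0; apply: derivableD; [exact: fD|exact: gD]. Qed.

Lemma dx_existsN f : dx_exists Omega f -> dx_exists Omega (fun y s => - f y s).
Proof. by move=> fD i x t Ox t0; apply: derivableN; exact: fD. Qed.

Lemma dx_existsM f g : dx_exists Omega f -> dx_exists Omega g ->
  dx_exists Omega (fun y s => f y s * g y s).
Proof. by move=> fD gD i x t Ox t0; apply: derivableM; [exact: fD|exact: gD]. Qed.

Lemma dx_existsV f : (forall x t, Omega x -> 0 <= t -> f x t != 0) ->
  dx_exists Omega f -> dx_exists Omega (fun y s => (f y s)^-1).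
Proof. by move=> f0 fD i x t Ox t0; apply: derivableV; [exact: f0|exact: fD]. Qed.

Lemma dx_exists_sum p (f : 'I_p -> sfield R n) :
  (forall k, dx_exists Omega (f k)) ->
  dx_exists Omega (fun y s => \sum_k f k y s).
Proof.
move=> fD i x t Ox t0.
by have [] := has_D_sum (fun k => has_D_dx i (fD k) Ox t0).
Qed.

End DirectionalRegularity.

(** * Algebra of the energy balance and of the dissipation *)

Section Dissipation.
Context {R : realType}.

Lemma sum_sqr_le n (a : 'I_n -> R) :
  (\sum_i a i) ^+ 2 <= n%:R * \sum_i a i ^+ 2.
Proof.
have : 0 <= \sum_i \sum_j (a i - a j) ^+ 2.
  by do 2![apply: sumr_ge0 => ? _]; exact: sqr_ge0.
have -> : \sum_i \sum_j (a i - a j) ^+ 2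
    = 2 * (n%:R * \sum_i a i ^+ 2) - 2 * (\sum_i a i) ^+ 2.
  have sumC (b : R) : \sum_(i < n) b = n%:R * b.
    by rewrite sumr_const card_ord mulr_natl.
  set S := \sum_i a i; set T := \sum_i a i ^+ 2.
  rewrite (eq_bigr (fun i => n%:R * a i ^+ 2 + - 2 * S * a i + T)).
    by rewrite !big_split /= sumC -!mulr_sumr -/S -/T; ring.
  move=> i _; rewrite -sumC /T /S mulr_sumr mulr_suml -!big_split /=.
  by apply: eq_bigr => j _; ring.
by move=> h; lra.
Qed.

(** In dimension at most three the trace part of the viscous dissipation is
    absorbed by the diagonal of the symmetrized gradient; the constant [2/3]
    is sharp for [n = 3]. *)
Lemma viscous_dissipation_ge0 n (G : 'I_n -> 'I_n -> R) (mu lam : R) :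
  (n <= 3)%N -> 0 <= mu -> 0 <= lam ->
  0 <= mu / 2 * (\sum_i \sum_j (G i j + G j i) ^+ 2)
       + (lam - 2 / 3 * mu) * (\sum_i G i i) ^+ 2.
Proof.
move=> n3 mu0 lam0.
have diag : 4 * (\sum_i G i i ^+ 2) <= \sum_i \sum_j (G i j + G j i) ^+ 2.
  rewrite mulr_sumr; apply: ler_sum => i _; rewrite (bigD1 i)//=.
  rewrite (_ : 4 * _ = (G i i + G i i) ^+ 2); last by ring.
  by rewrite lerDl sumr_ge0// => j _; exact: sqr_ge0.
have tr := sum_sqr_le (fun i => G i i).
have n3' : n%:R * (\sum_i G i i ^+ 2) <= 3 * (\sum_i G i i ^+ 2).
  rewrite ler_wpM2r ?(ler_nat _ n 3)//.
  by apply: sumr_ge0 => i _; exact: sqr_ge0.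
have lamT : 0 <= lam * (\sum_i G i i) ^+ 2 by rewrite mulr_ge0// sqr_ge0.
have shear : 0 <= 2^-1 * (\sum_i \sum_j (G i j + G j i) ^+ 2)
    - 2 / 3 * (\sum_i G i i) ^+ 2 by lra.
by have := mulr_ge0 mu0 shear; lra.
Qed.

(** The work of the stress against the velocity gradient only sees its
    symmetric part. *)
Lemma viscous_work n (G : 'I_n -> 'I_n -> R) (mu l : R) :
  \sum_i \sum_j G i j * (mu * (G i j + G j i) + l *+ (i == j))
  = mu / 2 * (\sum_i \sum_j (G i j + G j i) ^+ 2) + l * \sum_i G i i.
Proof.
have -> : \sum_i \sum_j (G i j + G j i) ^+ 2
    = 2 * \sum_i \sum_j G i j * (G i j + G j i).
  have -> : \sum_i \sum_j (G i j + G j i) ^+ 2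
      = \sum_i \sum_j G i j * (G i j + G j i)
      + \sum_i \sum_j G j i * (G i j + G j i).
    rewrite -big_split; apply: eq_bigr => i _ /=; rewrite -big_split /=.
    by apply: eq_bigr => j _; ring.
  rewrite mulrDl mul1r; congr (_ + _); rewrite exchange_big /=.
  by apply: eq_bigr => i _; apply: eq_bigr => j _; rewrite [G j i + _]addrC.
rewrite mulrA divfK ?pnatr_eq0// !mulr_sumr -big_split /=.
apply: eq_bigr => i _.
rewrite mulr_sumr (bigD1 i)//= [in RHS](bigD1 i)//= eqxx mulr1n.
rewrite (eq_bigr (fun j => mu * (G i j * (G i j + G j i)))); first by ring.
by move=> j ji; rewrite eq_sym (negPf ji) mulr0n addr0; ring.
Qed.

(** Subtracting from the total energy balance the momentum balance multiplied
    by the velocity leaves a balance of internal energy. The regularizing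
    stress [rho u (x) w] then combines with the work of the pressure and of the
    force along [w] into [rho w . (u . grad u + grad p / rho - f)], which is
    the square [rho |w|^2 / tau] by the very choice of [w]. This is pure
    algebra at one point: derivatives enter as unrelated numbers, [du j o] for
    those of [u_j], [gp] for [grad p], [dPi i j] for the [i]th derivative of the
    entry [(i, j)] of the whole stress, [D] for [div v], [heat] for
    [div (kappa grad theta)]. *)
Lemma internal_energy_balance n (rho tau e p heat Q D : R)
    (u w f gp : 'I_n -> R) (PiN dPi : 'I_n -> 'I_n -> R)
    (drho de : option 'I_n -> R) (du : 'I_n -> option 'I_n -> R) :
  let v i := u i - w i in
  rho != 0 -> tau != 0 ->
  (forall j, w j = tau * (\sum_i u i * du j (Some i) + rho^-1 * gp j - f j)) ->
  matd v drho + rho * D = 0 ->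
  (forall j, matd v (fun o => drho o * u j + rho * du j o) + rho * u j * D
     + gp j = \sum_i dPi i j + rho * f j) ->
  matd v (fun o => 2^-1 * (drho o * (\sum_j u j * u j)
                     + rho * (\sum_j (du j o * u j + u j * du j o))) + de o)
    + (2^-1 * rho * (\sum_j u j * u j) + e) * D
    + (\sum_i v i * gp i + p * D)
  = heat + \sum_i \sum_j (du j (Some i) * (PiN i j + rho * (u i * w j))
                       + u j * dPi i j)
    + rho * (\sum_i v i * f i) + Q ->
  matd v de + e * D + p * D
  = heat + \sum_i \sum_j du j (Some i) * PiN i j
    + rho / tau * (\sum_j w j * w j) + Q.
Proof.
move=> v rho0 tau0 wE mass mom en.
have massE : matd v drho = - (rho * D) by lra.
pose A := \sum_j u j * matd v (du j).
have kin : rho * A + \sum_j u j * gp j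
    = \sum_i \sum_j u j * dPi i j + rho * (\sum_j u j * f j).
  rewrite exchange_big /= !mulr_sumr -!big_split /=; apply: eq_bigr => j _.
  have := mom j.
  rewrite (@eq_matd _ _ v _ (fun o => u j * drho o + rho * du j o)); last first.
    by move=> o; rewrite mulrC.
  rewrite matdD !matdZ massE -mulr_sumr => /(congr1 ( *%R (u j))) momj.
  by lra.
have enE : matd v (fun o => 2^-1 * (drho o * (\sum_j u j * u j)
      + rho * (\sum_j (du j o * u j + u j * du j o))) + de o)
    = - (2^-1 * (\sum_j u j * u j) * (rho * D)) + rho * A + matd v de.
  rewrite matdD; congr (_ + _).
  rewrite (@eq_matd _ _ v _ (fun o => 2^-1 * (\sum_j u j * u j) * drho o
      + rho * \sum_j u j * du j o)); last first.
    move=> o.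
    have -> : \sum_j (du j o * u j + u j * du j o) = 2 * \sum_j u j * du j o.
      by rewrite mulr_sumr; apply: eq_bigr => j _; ring.
    by field.
  rewrite matdD !matdZ massE matd_sum /A; congr (_ + _ * _); first by ring.
  by apply: eq_bigr => j _; rewrite matdZ.
have regE : \sum_i \sum_j (du j (Some i) * (PiN i j + rho * (u i * w j))
      + u j * dPi i j)
    = \sum_i \sum_j du j (Some i) * PiN i j
    + rho * (\sum_j w j * \sum_i u i * du j (Some i))
    + \sum_i \sum_j u j * dPi i j.
  have -> : \sum_j w j * (\sum_i u i * du j (Some i))
      = \sum_j \sum_i w j * (u i * du j (Some i)).
    by apply: eq_bigr => j _; rewrite mulr_sumr.
  rewrite [in X in rho * X]exchange_big /= !mulr_sumr -!big_split /=.
  apply: eq_bigr => i _; rewrite mulr_sumr -!big_split /=.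
  by apply: eq_bigr => j _; ring.
have wsq : rho / tau * (\sum_j w j * w j)
    = rho * (\sum_j w j * \sum_i u i * du j (Some i))
      + \sum_j w j * gp j - rho * (\sum_j w j * f j).
  rewrite !mulr_sumr -sumrN -!big_split /=; apply: eq_bigr => j _.
  by rewrite {2}wE; field; rewrite rho0 tau0.
have vgp : \sum_i v i * gp i = \sum_i u i * gp i - \sum_i w i * gp i.
  by rewrite -sumrB; apply: eq_bigr => i _; rewrite mulrBl.
have vf : \sum_i v i * f i = \sum_i u i * f i - \sum_i w i * f i.
  by rewrite -sumrB; apply: eq_bigr => i _; rewrite mulrBl.
rewrite enE regE vgp vf in en; rewrite wsq; lra.
Qed.

End Dissipation.

(** * Gibbs relation of the mixture *)

Section Gibbs.
Context {R : realType} {n : nat} (c : constants R) (m : mixture R n).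

(** The entropy of a component in the variables temperature and density. *)
Definition comp_entropy (K : 'I_2 -> R) (k : 'I_2) : sfield R n := fun y s =>
  cV c k * ln (mtheta m y s) - Rg c k * ln (mr m k y s) + K k.

Definition entropy_density (K : 'I_2 -> R) : sfield R n := fun y s =>
  \sum_k rhok m k y s * comp_entropy K k y s.

Lemma theta_re_energy k r th : theta_re c k r (energy c k r th) = th.
Proof.
rewrite /theta_re /energy; have cV0 : cV c k != 0 by rewrite gt_eqF ?cV_gt0.
by rewrite addrK addrK mulrC mulKf.
Qed.

Lemma rho_mix_entropyE (sk : 'I_2 -> R -> R -> R) (K : 'I_2 -> R) y s :
  (forall k r e, 0 < r -> energy_min c k r < e ->
     sk k r e = entropy_fn c k r e + K k) ->
  (forall k, 0 < mr m k y s) ->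
  (forall k, 0 < press c k (mr m k y s) (mtheta m y s)) ->
  rho m y s != 0 ->
  rho m y s * mix_entropy c m sk y s = entropy_density K y s.
Proof.
move=> skE r0 p0 rho0; rewrite /mix_entropy mulrC divfK//.
apply: eq_bigr => k _; rewrite skE// ?/entropy_fn ?theta_re_energy//.
by rewrite -press_re_gt0// /press_re theta_re_energy.
Qed.

Section AtPoint.
Context (x : 'rV[R]_n) (t : R) (o : option 'I_n).
Local Notation has_D := (has_D x t o).
Local Notation d := (partial x t o).

Context (rD : forall k, has_D (mr m k) (d (mr m k))).
Context (alphaD : forall k, has_D (malpha m k) (d (malpha m k))).
Context (thetaD : has_D (mtheta m) (d (mtheta m))).

Lemma has_D_rhok k : has_D (rhok m k) (d (rhok m k)).
Proof. by have h := has_DM (alphaD k) (rD k); rewrite (has_D_partial h). Qed.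

Lemma has_D_rho : has_D (rho m) (\sum_k d (rhok m k)).
Proof. exact: has_D_sum has_D_rhok. Qed.

Context (r0 : forall k, 0 < mr m k x t).

Lemma has_D_rhoeps : has_D (rhoeps c m) (\sum_k (d (rhok m k) * epsk c m k x t
  + rhok m k x t * (cV c k * d (mtheta m)
                    - pst c k / mr m k x t ^+ 2 * d (mr m k)))).
Proof.
apply: has_D_sum => k; apply: has_DM (has_D_rhok k) _.
rewrite /epsk /energy; have rn : mr m k x t != 0 by rewrite gt_eqF.
apply: has_D_eq.
  apply: has_DD (has_D_cst _ _ _ _).
  apply: has_DD (has_DM (has_D_cst _ _ _ _) thetaD) _.
  exact: has_DM (has_D_cst _ _ _ _) (has_DV rn (rD k)).
by rewrite /=; field.
Qed.

Context (theta0 : 0 < mtheta m x t).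

Lemma has_D_entropy_density K : has_D (entropy_density K)
  (\sum_k (d (rhok m k) * comp_entropy K k x t
  + rhok m k x t * (cV c k * (d (mtheta m) / mtheta m x t)
                    - Rg c k * (d (mr m k) / mr m k x t)))).
Proof.
apply: has_D_sum => k; apply: has_DM (has_D_rhok k) _.
rewrite /comp_entropy; apply: has_D_eq.
  apply: has_DD (has_D_cst _ _ _ _).
  apply: has_DD (has_DM (has_D_cst _ _ _ _) (has_D_ln theta0 thetaD)) _.
  exact: has_DN (has_DM (has_D_cst _ _ _ _) (has_D_ln (r0 k) (rD k))).
by rewrite /=; ring.
Qed.

(** Gibbs relation of the mixture. Summing the Gibbs relations of the two
    components, weighted by their densities, leaves the term
    [p * (d alpha_1 + d alpha_2)]; it disappears because the pressure is
    common to the components and the volume fractions add up to one. *)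
Lemma gibbs K p :
  (forall k, p = press c k (mr m k x t) (mtheta m x t)) ->
  \sum_k d (malpha m k) = 0 ->
  mtheta m x t * d (entropy_density K)
  = d (rhoeps c m) - \sum_k (epsk c m k x t + p / mr m k x t
                     - mtheta m x t * comp_entropy K k x t) * d (rhok m k).
Proof.
move=> pE alpha0.
rewrite (has_D_partial (has_D_entropy_density K)) (has_D_partial has_D_rhoeps).
have palpha : p * (\sum_k d (malpha m k)) = 0 by rewrite alpha0 mulr0.
(* The vanishing term compensates the components one by one. *)
rewrite -[RHS]addr0 -[X in _ = _ + X]palpha.
rewrite !mulr_sumr -sumrB -big_split /=; apply: eq_bigr => k _.
have -> : d (rhok m k)
    = d (malpha m k) * mr m k x t + malpha m k x t * d (mr m k).
  exact: has_D_partial (has_DM (alphaD k) (rD k)).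
rewrite /rhok (pE k) /press; field.
by rewrite !gt_eqF.
Qed.

End AtPoint.
End Gibbs.

(** * Regularity along a solution *)

Section Regularity.
Context {R : realType} {n : nat} (Omega : set 'rV[R]_n).
Context (Omega_open : open Omega).
Context (c : constants R) (m : mixture R n) (d : qhd_data R n).
Context (sol : qhd_smooth_solution c m d Omega).

Local Notation u j := (fun y s => mvel m y s 0 j).
Local Notation w j := (fun y s => what m d y s 0 j).

Let reg : regular m d Omega := sol.1.

Lemma sol_adm x t : Omega x -> 0 <= t -> admissible_at c m d x t.
Proof. by move=> Ox t0; have [] := sol.2 x t Ox t0. Qed.

Lemma has_D_sol g : dt_exists Omega g /\ dxx_exists Omega g ->
  forall x t o, Omega x -> 0 <= t -> has_D x t o g (partial x t o g).
Proof.
move=> [gt [gx _]] x t [i|] Ox t0; first exact: has_D_dx Ox t0.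
exact: has_D_dt Ox t0.
Qed.

Lemma rho_gt0 x t : (forall k, 0 < mr m k x t) ->
  (forall k, 0 < malpha m k x t) -> 0 < rho m x t.
Proof.
move=> r0 al0; rewrite /rho big_ord_recl ltr_wpDr ?sumr_ge0//.
  by move=> k _; rewrite ltW ?mulr_gt0.
by rewrite mulr_gt0.
Qed.

Lemma sol_rho_gt0 x t : Omega x -> 0 <= t -> 0 < rho m x t.
Proof.
move=> Ox t0; have adm := sol_adm Ox t0.
apply: rho_gt0 => k; first exact: adm_r adm k.
by have /andP[] := adm_alpha adm k.
Qed.

(** The closure relation holds around every point of [Omega], but in time only
    for [0 <= t]. *)
Lemma partial_alpha_sum x t o : Omega x -> 0 <= t ->
  \sum_k partial x t o (malpha m k) = 0.
Proof.
move=> Ox t0.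
have sumD := has_D_sum (fun k => has_D_sol (reg_alpha reg k) o Ox t0).
have sum1 y s : Omega y -> 0 <= s -> \sum_k malpha m k y s = 1.
  by move=> Oy s0; exact: adm_alpha_sum (sol_adm Oy s0).
rewrite -(has_D_partial sumD); case: o sumD => [i|] sumD.
  apply: has_D_partial.
  apply: (has_D_local Omega_open Ox t0) (has_D_cst x t (Some i) 1) => y s Oy s0.
  by rewrite sum1.
rewrite (has_D_partial sumD); apply: derive_cst_future sumD _ => s ts.
by rewrite sum1// (le_trans t0).
Qed.

Lemma dx_exists_rho : dx_exists Omega (rho m).
Proof.
apply: dx_exists_sum => k.
have [_ [alphaD _]] := reg_alpha reg k; have [_ [rD _]] := reg_r reg k.
exact: dx_existsM.
Qed.

(* The pressure is not among the fields assumed differentiable: its derivatives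
   come from the equation of state of the component of index 0, used in a
   neighbourhood. *)
Let pE y s : Omega y -> 0 <= s ->
  Rg c 0 * mr m 0 y s * mtheta m y s + - pst c 0 = mp m y s.
Proof. by move=> Oy s0; rewrite (adm_p (sol_adm Oy s0) 0). Qed.

Let dp i : sfield R n := fun y s => Rg c 0 *
  (dx i (mr m 0) y s * mtheta m y s + mr m 0 y s * dx i (mtheta m) y s).

Let has_D_p i x t : Omega x -> 0 <= t -> has_D x t (Some i) (mp m) (dp i x t).
Proof.
move=> Ox t0; apply: (has_D_local Omega_open Ox t0 pE).
have rD := has_D_sol (reg_r reg 0) (Some i) Ox t0.
have thD := has_D_sol (reg_theta reg) (Some i) Ox t0.
have RrthD := has_DM (has_DM (has_D_cst x t (Some i) (Rg c 0)) rD) thD.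
apply: has_D_eq (has_DD RrthD (has_D_cst _ _ _ (- pst c 0))) _.
by rewrite /dp /=; ring.
Qed.

Lemma dx_exists_p : dx_exists Omega (mp m).
Proof. exact: has_D_dx_exists has_D_p. Qed.

Lemma dxx_exists_p i : dx_exists Omega (dx i (mp m)).
Proof.
have [_ [r1 r2]] := reg_r reg 0; have [_ [th1 th2]] := reg_theta reg.
apply: (dx_exists_local Omega_open (f := dp i)).
  by move=> y s Oy s0; rewrite [RHS](has_D_partial (has_D_p i Oy s0)).
apply: dx_existsM; first exact: dx_exists_cst.
by apply: dx_existsD; apply: dx_existsM.
Qed.

Lemma dx_exists_u j : dx_exists Omega (u j).
Proof. by have [_ []] := reg_u reg j. Qed.

Lemma dxx_exists_u i j : dx_exists Omega (dx i (u j)).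
Proof. by have [_ []] := reg_u reg j. Qed.

Lemma whatE y s j : what m d y s 0 j =
  dtau d y s * (\sum_i mvel m y s 0 i * dx i (u j) y s
                + (rho m y s)^-1 * dx j (mp m) y s - df d y s 0 j).
Proof.
rewrite /what !mxE; congr (_ * (_ + _ - _)).
by apply: eq_bigr => i _; rewrite mxE.
Qed.

Lemma regvelE y s j : regvel m d y s 0 j = mvel m y s 0 j - what m d y s 0 j.
Proof. by rewrite !mxE. Qed.

Lemma dx_exists_w j : dx_exists Omega (w j).
Proof.
apply: (dx_exists_local Omega_open) => [y s _ _|]; first by rewrite whatE.
apply: dx_existsM; first exact: reg_tau reg.
apply: dx_existsD; last by apply: dx_existsN; exact: reg_f reg j.
apply: dx_existsD.
  apply: dx_exists_sum => i; apply: dx_existsM; first exact: dx_exists_u.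
  exact: dxx_exists_u.
apply: dx_existsM; last exact: dxx_exists_p.
apply: dx_existsV; last exact: dx_exists_rho.
by move=> x t Ox t0; rewrite gt_eqF// sol_rho_gt0.
Qed.

Lemma PiNSE y s i j : PiNS m d y s i j =
  dmu d y s * (dx i (u j) y s + dx j (u i) y s)
  + (dlambda d y s - 2 / 3 * dmu d y s) * div (mvel m) y s *+ (i == j).
Proof. by rewrite /PiNS !mxE. Qed.

Lemma PiTotE y s i j : PiTot m d y s i j =
  PiNS m d y s i j + rho m y s * (mvel m y s 0 i * what m d y s 0 j).
Proof. by rewrite /PiTot mxE /PiTau !mxE. Qed.

Lemma dx_exists_Pi i j : dx_exists Omega (fun y s => PiTot m d y s i j).
Proof.
have muD := reg_mu reg; have lamD := reg_lambda reg.
apply: (dx_exists_local Omega_open) => [y s _ _|].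
  by rewrite PiTotE PiNSE -mulr_natr.
apply: dx_existsD.
  apply: dx_existsD.
    apply: dx_existsM => //.
    by apply: dx_existsD; exact: dxx_exists_u.
  apply: dx_existsM; last exact: dx_exists_cst.
  apply: dx_existsM.
    apply: dx_existsD => //; apply: dx_existsN.
    by apply: dx_existsM => //; exact: dx_exists_cst.
  by apply: dx_exists_sum => k; exact: dxx_exists_u.
apply: dx_existsM; first exact: dx_exists_rho.
by apply: dx_existsM; [exact: dx_exists_u|exact: dx_exists_w].
Qed.

Lemma dx_exists_heat i :
  dx_exists Omega (fun y s => dkappa d y s * dx i (mtheta m) y s).
Proof.
have [_ [_ th2]] := reg_theta reg.
by apply: dx_existsM => //; exact: reg_kappa reg.
Qed.

End Regularity.

(** * Entropy balance *)

Section EntropyBalance.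
Context {R : realType} {n : nat} (Omega : set 'rV[R]_n).
Context (Omega_open : open Omega).
Context (c : constants R) (m : mixture R n) (d : qhd_data R n).
Context (sol : qhd_smooth_solution c m d Omega).
Context (sk : 'I_2 -> R -> R -> R) (K : 'I_2 -> R).
Context (skE : forall k r e, 0 < r -> energy_min c k r < e ->
  sk k r e = entropy_fn c k r e + K k).

Local Notation rhos := (fun y s => rho m y s * mix_entropy c m sk y s).
Local Notation H := (entropy_density c m K).

Lemma near_pos (x : 'rV[R]_n) (t : R) (g : sfield R n) dg :
  has_D x t None g dg -> 0 < g x t -> \forall s \near t, 0 < g x s.
Proof.
move=> [gD _]; have gc : {for t, continuous (g x)}.
  exact/differentiable_continuous/derivable1_diffP.
exact: cvgr_gt gc _.
Qed.

(** At [t = 0] this needs the state to remain physical for slightly negative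
    times, which continuity provides for the strict inequalities. *)
Lemma has_D_rhos x t o : Omega x -> 0 <= t -> has_D x t o rhos (partial x t o H).
Proof.
move=> Ox t0; have [reg _] := sol; have adm := sol_adm sol Ox t0.
have rD k o' := has_D_sol (reg_r reg k) o' Ox t0.
have alD k o' := has_D_sol (reg_alpha reg k) o' Ox t0.
have thD o' := has_D_sol (reg_theta reg) o' Ox t0.
have HD o' : has_D x t o' H (partial x t o' H).
  have h := has_D_entropy_density c (fun k => rD k o') (fun k => alD k o')
    (thD o') (adm_r adm) (adm_theta adm) K.
  by rewrite (has_D_partial h).
case: o => [i|].
  apply: (has_D_local Omega_open Ox t0) (HD (Some i)) => y s Oy s0.
  have admy := sol_adm sol Oy s0; rewrite (rho_mix_entropyE (K := K))//.
  - exact: adm_r admy.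
  - by move=> k; rewrite -(adm_p admy) (adm_p_gt0 admy).
  - by rewrite gt_eqF// (sol_rho_gt0 sol).
apply: near_eq_is_derive (HD None).
have pD k := has_DD (has_DM (has_DM (has_D_cst x t None (Rg c k)) (rD k None))
  (thD None)) (has_D_cst x t None (- pst c k)).
have r_near : \forall s \near t, forall k, 0 < mr m k x s.
  apply: (@filter_forall _ _ (fun k s => 0 < mr m k x s) (nbhs t) _) => k.
  exact: near_pos (rD k None) (adm_r adm k).
have al_near : \forall s \near t, forall k, 0 < malpha m k x s.
  apply: (@filter_forall _ _ (fun k s => 0 < malpha m k x s) (nbhs t) _) => k.
  have /andP[al0 _] := adm_alpha adm k.
  exact: near_pos (alD k None) al0.
have p_near : \forall s \near t, forall k,
    0 < press c k (mr m k x s) (mtheta m x s).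
  apply: (@filter_forall _ _
    (fun k s => 0 < press c k (mr m k x s) (mtheta m x s)) (nbhs t) _) => k.
  have p0 := adm_p_gt0 adm; rewrite (adm_p adm k) in p0.
  exact: near_pos (pD k) p0.
near=> s.
have r0 : forall k, 0 < mr m k x s by near: s.
rewrite (rho_mix_entropyE (K := K))//; first by near: s.
by rewrite gt_eqF// rho_gt0//; near: s.
Unshelve. all: by end_near. Qed.

Section AtPoint.
Context (x : 'rV[R]_n) (t : R) (Ox : Omega x) (t0 : 0 <= t).

Let reg : regular m d Omega := sol.1.
Let adm : admissible_at c m d x t := sol_adm sol Ox t0.

Local Notation u j := (mvel m x t 0 j).
Local Notation w j := (what m d x t 0 j).
Local Notation v := (fun i => mvel m x t 0 i - what m d x t 0 i).
Local Notation du j o := (partial x t o (fun y s => mvel m y s 0 j)).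
Local Notation dw i := (dx i (fun y s => what m d y s 0 i) x t).
Local Notation D := (\sum_i (du i (Some i) - dw i)).
Local Notation drho o := (\sum_k partial x t o (rhok m k)).
Local Notation de o := (partial x t o (rhoeps c m)).
Local Notation gp i := (dx i (mp m) x t).
Local Notation heat i := (fun y s => dkappa d y s * dx i (mtheta m) y s).

Let rD o k : has_D x t o (mr m k) (partial x t o (mr m k)).
Proof. exact (has_D_sol (reg_r reg k) o Ox t0). Qed.

Let alphaD o k : has_D x t o (malpha m k) (partial x t o (malpha m k)).
Proof. exact (has_D_sol (reg_alpha reg k) o Ox t0). Qed.

Let thetaD o : has_D x t o (mtheta m) (partial x t o (mtheta m)).
Proof. exact (has_D_sol (reg_theta reg) o Ox t0). Qed.

Let uD o j : has_D x t o (fun y s => mvel m y s 0 j) (du j o).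
Proof. exact (has_D_sol (g := fun y s => mvel m y s 0 j) (reg_u reg j) o Ox t0). Qed.

Let rhokD o k : has_D x t o (rhok m k) (partial x t o (rhok m k)).
Proof. exact: has_D_rhok. Qed.

Let rhoD o : has_D x t o (rho m) (drho o).
Proof. exact: has_D_rho. Qed.

Let eD o : has_D x t o (rhoeps c m) (de o).
Proof.
have h := has_D_rhoeps c (rD o) (alphaD o) (thetaD o) (adm_r adm).
by rewrite (has_D_partial h).
Qed.

Let wD i : has_D x t (Some i) (fun y s => what m d y s 0 i) (dw i).
Proof. by apply: has_D_dx Ox t0; apply: (dx_exists_w Omega_open sol). Qed.

Let pD i : has_D x t (Some i) (mp m) (gp i).
Proof. by apply: has_D_dx Ox t0; apply: (dx_exists_p Omega_open sol). Qed.

Let heatD i : has_D x t (Some i) (heat i) (dx i (heat i) x t).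
Proof. by apply: has_D_dx Ox t0; apply: (dx_exists_heat sol). Qed.

Let PiD i j : has_D x t (Some i) (fun y s => PiTot m d y s i j)
  (dx i (fun y s => PiTot m d y s i j) x t).
Proof. by apply: has_D_dx Ox t0; apply: (dx_exists_Pi Omega_open sol). Qed.

Let vD i : has_D x t (Some i) (fun y s => regvel m d y s 0 i) (du i (Some i) - dw i).
Proof.
refine (has_D_ext _ (has_DD (uD (Some i) i) (has_DN (wD i)))).
by move=> y s; rewrite !mxE.
Qed.

Let transport_sol (g : sfield R n) (dg : option 'I_n -> R) :
  (forall o, has_D x t o g (dg o)) ->
  dt g x t + div (fun y s => g y s *: regvel m d y s) x t
  = matd v dg + g x t * D.
Proof.
move=> gD; rewrite (transportE gD vD); congr (_ + _).
by rewrite /matd; congr (_ + _); apply: eq_bigr => i _; rewrite !mxE.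
Qed.

Let mass k : matd v (fun o => partial x t o (rhok m k)) + rhok m k x t * D = 0.
Proof.
rewrite -(transport_sol (fun o => rhokD o k)).
by have [_ /(_ x t Ox t0)[_ []]] := sol.
Qed.

(** The conservation laws, once their divergences are expanded, meet the
    hypotheses of [internal_energy_balance]. *)
Lemma internal_energy_along_solution :
  matd v (fun o => de o) + rhoeps c m x t * D + mp m x t * D
  = \sum_i dx i (heat i) x t
    + \sum_i \sum_j dx i (fun y s => mvel m y s 0 j) x t * PiNS m d x t i j
    + rho m x t / dtau d x t * (\sum_j w j * w j) + dQ d x t.
Proof.
have [_ /(_ x t Ox t0)[_ [_ mom en]]] := sol.
have totD o : has_D x t o (toten c m)
    (2^-1 * (drho o * (\sum_j u j * u j)
             + rho m x t * (\sum_j (du j o * u j + u j * du j o))) + de o).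
  apply: has_DD (eD o).
  have sqD := has_D_sum (fun j => has_DM (uD o j) (uD o j)).
  apply: has_D_eq (has_DM (has_DM (has_D_cst x t o 2^-1) (rhoD o)) sqD) _.
  by rewrite mul0r add0r mulrDr !mulrA.
apply: (internal_energy_balance (rho := rho m x t) (u := fun j => u j)
  (gp := fun i => gp i) (f := fun j => df d x t 0 j)
  (du := fun j o => du j o) (drho := fun o => drho o)
  (dPi := fun i j => dx i (fun y s => PiTot m d y s i j) x t)).
- by rewrite gt_eqF// (sol_rho_gt0 sol).
- by rewrite gt_eqF// (adm_tau adm).
- by move=> j; rewrite whatE.
- rewrite matd_sum /rho mulr_suml -big_split /=.
  by rewrite big1// => k _; exact: mass.
- move=> j; have := congr1 (fun M : 'rV_n => M 0 j) mom.
  rewrite !mxE (@dt_row _ _ _ _ _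
    (fun j => partial x t None (fun y s => rho m y s * mvel m y s 0 j)));
    last first.
    move=> k; have h := has_DM (rhoD None) (uD None k).
    by rewrite (has_D_partial h); apply: has_D_ext h => y s; rewrite mxE.
  have := transport_sol (fun o => has_DM (rhoD o) (uD o j)).
  rewrite /= => <-; rewrite /div => momj; rewrite -momj; congr (_ + _ + _).
  apply: eq_bigr => i _; congr (dx i _ x t).
  by apply/funext => y; apply/funext => s; rewrite !mxE; ring.
- have pressure_work : div (fun y s => (toten c m y s + mp m y s) *: regvel m d y s) x t
      = div (fun y s => toten c m y s *: regvel m d y s) x t
        + (\sum_i v i * gp i + mp m x t * D).
    rewrite mulr_sumr -!big_split /=; apply: eq_bigr => i _.
    have Ev := has_DM (totD (Some i)) (vD i).
    have pv := has_DM (pD i) (vD i).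
    transitivity (partial x t (Some i) (fun y s => toten c m y s * regvel m d y s 0 i
                                          + mp m y s * regvel m d y s 0 i)).
      by congr (dx i _ x t); apply/funext => y; apply/funext => s; rewrite mxE mulrDl.
    rewrite (has_D_partial (has_DD Ev pv)) -(has_D_partial Ev); congr (_ + _).
      by congr (dx i _ x t); apply/funext => y; apply/funext => s; rewrite [RHS]mxE.
    by rewrite !mxE /=; ring.
  have stress_work : div (fun y s => - qF m d y s + mvel m y s *m (PiTot m d y s)^T) x t
      = \sum_i dx i (heat i) x t + \sum_i \sum_j (du j (Some i) * PiTot m d x t i j
          + u j * dx i (fun y s => PiTot m d y s i j) x t).
    rewrite -big_split /=; apply: divE => i.
    refine (has_D_ext _ (has_DD (heatD i)
      (has_D_sum (fun j => has_DM (uD (Some i) j) (PiD i j))))).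
    move=> y s; rewrite !mxE opprK; congr (_ + _).
    by apply: eq_bigr => j _; rewrite !mxE.
  have totE : toten c m x t
      = 2^-1 * rho m x t * (\sum_j u j * u j) + rhoeps c m x t by [].
  rewrite -totE -(transport_sol totD) -addrA.
  move: en; rewrite pressure_work addrA stress_work => ->.
  congr (_ + _ + _ * _ + _).
    by apply: eq_bigr => i _; apply: eq_bigr => j _; rewrite PiTotE.
  by apply: eq_bigr => i _; rewrite !mxE.
Qed.

Let dH o := partial x t o H.

Let rhosE : rho m x t * mix_entropy c m sk x t = H x t.
Proof.
rewrite (rho_mix_entropyE (K := K))//; first exact: adm_r adm.
- by move=> k; rewrite -(adm_p adm) (adm_p_gt0 adm).
- by rewrite gt_eqF// (sol_rho_gt0 sol).
Qed.

(** The Gibbs relation along the flow: the chemical potentials only meet the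
    densities, whose transport is pure dilatation, and Euler's relation
    collects what they leave into the work of the pressure. *)
Lemma entropy_transport : mtheta m x t * (matd v dH + H x t * D)
  = matd v (fun o => de o) + rhoeps c m x t * D + mp m x t * D.
Proof.
pose G k := epsk c m k x t + mp m x t / mr m k x t
            - mtheta m x t * comp_entropy c m K k x t.
have GE o : mtheta m x t * dH o
    = de o + \sum_k - G k * partial x t o (rhok m k).
  rewrite /dH (gibbs (rD o) (alphaD o) (thetaD o) (adm_r adm) (adm_theta adm) K
    (adm_p adm) (partial_alpha_sum Omega_open sol o Ox t0)) -sumrN.
  by congr (_ + _); apply: eq_bigr => k _; rewrite mulNr.
have euler : \sum_k G k * rhok m k x t
    = rhoeps c m x t + mp m x t - mtheta m x t * H x t.
  rewrite -[X in _ + X - _]mulr1 -(adm_alpha_sum adm) !mulr_sumr -sumrN -!big_split /=.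
  apply: eq_bigr => k _; rewrite /G /rhok; field.
  by rewrite gt_eqF// (adm_r adm).
rewrite mulrDr -matdZ (eq_matd _ GE) matdD matd_sum.
rewrite (eq_bigr (fun k => G k * rhok m k x t * D)) -?mulr_suml ?euler; first by ring.
move=> k _; rewrite matdZ; have := mass k => /eqP; rewrite addr_eq0 => /eqP ->.
by ring.
Qed.

Definition entropy_production : R :=
    (mtheta m x t)^-1 *
      (dmu d x t / 2 * frobsq (gradv (mvel m) x t + (gradv (mvel m) x t)^T)
       + (dlambda d x t - 2 / 3 * dmu d x t) * (div (mvel m) x t) ^+ 2
       + dkappa d x t / mtheta m x t * norm2sq (grad (mtheta m) x t)
       + rho m x t / dtau d x t * norm2sq (what m d x t)
       + dQ d x t).

Let frobE : frobsq (gradv (mvel m) x t + (gradv (mvel m) x t)^T)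
  = \sum_i \sum_j (dx i (fun y s => mvel m y s 0 j) x t
                   + dx j (fun y s => mvel m y s 0 i) x t) ^+ 2.
Proof. by apply: eq_bigr => i _; apply: eq_bigr => j _; rewrite !mxE. Qed.

Lemma entropy_balance_at :
  dt rhos x t + div (fun y s =>
    (rho m y s * mix_entropy c m sk y s) *: (mvel m y s - what m d y s)
    + (mtheta m y s)^-1 *: qF m d y s) x t
  = entropy_production.
Proof.
rewrite /entropy_production.
have th0 : mtheta m x t != 0 by rewrite gt_eqF// (adm_theta adm).
have HD o : has_D x t o rhos (dH o) by exact: has_D_rhos.
rewrite (@divE _ _ _ _ _ (fun i => (dH (Some i) * v i + H x t * (du i (Some i) - dw i))
  + (dkappa d x t / mtheta m x t ^+ 2 * dx i (mtheta m) x t ^+ 2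
     - (mtheta m x t)^-1 * dx i (heat i) x t))); last first.
  move=> i; apply: has_D_eq.
    refine (has_D_ext _ (has_DD (has_DM (HD (Some i)) (vD i))
      (has_DM (has_DV th0 (thetaD (Some i))) (has_DN (heatD i))))).
    by move=> y s; rewrite !mxE.
  by rewrite /= rhosE regvelE; field.
have -> : dt rhos x t = dH None := has_D_partial (HD None).
rewrite (_ : \sum_i _ = \sum_i v i * dH (Some i) + H x t * D
    + (dkappa d x t / mtheta m x t ^+ 2 * (\sum_i dx i (mtheta m) x t ^+ 2)
       - (mtheta m x t)^-1 * \sum_i dx i (heat i) x t)); last first.
  rewrite !mulr_sumr -sumrB -!big_split; apply: eq_bigr => i _.
  by rewrite [v i * _]mulrC.
rewrite !addrA -[dH None + _]/(matd v dH).
have viscous : \sum_i \sum_j dx i (fun y s => mvel m y s 0 j) x t * PiNS m d x t i j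
    = dmu d x t / 2 * frobsq (gradv (mvel m) x t + (gradv (mvel m) x t)^T)
    + (dlambda d x t - 2 / 3 * dmu d x t) * (div (mvel m) x t) ^+ 2.
  rewrite [X in _ + _ * X]expr2 mulrA.
  rewrite frobE -viscous_work; apply: eq_bigr => i _; apply: eq_bigr => j _.
  by rewrite PiNSE.
have gradE : norm2sq (grad (mtheta m) x t) = \sum_i dx i (mtheta m) x t ^+ 2.
  by apply: eq_bigr => i _; rewrite !mxE expr2.
rewrite gradE -viscous.
have := internal_energy_along_solution; rewrite -entropy_transport.
move=> /(canRL (mulKf th0)) ->.
rewrite -[\sum_j w j * w j]/(norm2sq _).
by field; rewrite th0 gt_eqF // (adm_tau adm).
Qed.

Lemma production_ge0 : (n <= 3)%N -> 0 <= entropy_production.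
Proof.
rewrite /entropy_production => n3; have th0 := adm_theta adm.
have sq0 (a : 'rV[R]_n) : 0 <= norm2sq a.
  by apply: sumr_ge0 => i _; rewrite -expr2 sqr_ge0.
apply: mulr_ge0; first by rewrite invr_ge0 ltW.
apply: addr_ge0 (adm_Q adm); apply: addr_ge0; first apply: addr_ge0.
- rewrite frobE; exact: (viscous_dissipation_ge0
    (fun i j => dx i (fun y s => mvel m y s 0 j) x t) n3 (adm_mu adm) (adm_lambda adm)).
- by rewrite mulr_ge0// divr_ge0 ?(adm_kappa adm)// ltW.
- by rewrite mulr_ge0// divr_ge0 ?ltW ?(sol_rho_gt0 sol) ?(adm_tau adm).
Qed.

End AtPoint.
End EntropyBalance.

Theorem proposition8 (R : realType) (n : nat) (hn : (1 <= n <= 3)%N)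
    (Omega : set 'rV[R]_n) (Omega_open : open Omega)
    (c : constants R) (m : mixture R n) (d : qhd_data R n)
    (sol : qhd_smooth_solution c m d Omega)
    (sk : 'I_2 -> R -> R -> R) (sk_entropy : component_entropy c sk) :
  let rhos : sfield R n := fun x t => rho m x t * mix_entropy c m sk x t in
  let flux : vfield R n := fun x t =>
    rhos x t *: (mvel m x t - what m d x t)
    + (mtheta m x t)^-1 *: qF m d x t in
  let production : sfield R n := fun x t =>
    (mtheta m x t)^-1 *
      (dmu d x t / 2 * frobsq (gradv (mvel m) x t + (gradv (mvel m) x t)^T)
       + (dlambda d x t - 2 / 3 * dmu d x t) * (div (mvel m) x t) ^+ 2
       + dkappa d x t / mtheta m x t * norm2sq (grad (mtheta m) x t)
       + rho m x t / dtau d x t * norm2sq (what m d x t)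
       + dQ d x t) in
  [/\ dt_exists Omega rhos,
      forall i, dx_exists Omega (fun x t => flux x t 0 i) &
      forall (x : 'rV[R]_n) (t : R), Omega x -> 0 <= t ->
        dt rhos x t + div flux x t = production x t /\ 0 <= production x t].
Proof.
move=> rhos flux production.
have [K skE] := component_entropyE sk_entropy.
have rhosD := has_D_rhos Omega_open sol skE.
split.
- by move=> x t Ox t0; have [] := rhosD x t None Ox t0.
- move=> i.
  have rhosx : dx_exists Omega rhos.
    by move=> j x t Ox t0; have [] := rhosD x t (Some j) Ox t0.
  apply: (dx_exists_local Omega_open (f := fun y s =>
      rhos y s * (mvel m y s 0 i - what m d y s 0 i)
      + (mtheta m y s)^-1 * - (dkappa d y s * dx i (mtheta m) y s))).
    by move=> y s _ _; rewrite /flux /qF !mxE.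
  apply: dx_existsD; apply: dx_existsM.
  + exact: rhosx.
  + apply: dx_existsD; first exact: (dx_exists_u sol).
    by apply: dx_existsN; apply: (dx_exists_w Omega_open sol).
  + apply: dx_existsV; last by have [_ []] := reg_theta sol.1.
    by move=> x t Ox t0; rewrite gt_eqF// (adm_theta (sol_adm sol Ox t0)).
  + by apply: dx_existsN; apply: (dx_exists_heat sol).
- move=> x t Ox t0; split; first exact: (entropy_balance_at Omega_open sol skE Ox t0).
  by apply: (production_ge0 sol Ox t0); case/andP: hn.
Qed.
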